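(* Let $\mathcal{A}$ and $\mathcal{U}$ be Banach algebras, $\theta$ a nonzero character on $\mathcal{A}$, $\mathcal{X}$ a Banach $(\mathcal{A}\times_{\theta}\mathcal{U})$-bimodule, and $D:\mathcal{A}\times_{\theta}\mathcal{U}\to\mathcal{X}$ a derivation; let $\delta_1(a)=D((a,0))$ and $\delta_2(u)=D((0,u))$. Then: (i) $\mathfrak{S}(\delta_1)$ is an $\mathcal{A}$-subbimodule of $\mathcal{X}$ and $\mathfrak{S}(\delta_1)\subseteq \mathrm{ann}_{\mathcal{X}}\mathcal{U}$; (ii) $\mathfrak{S}(\delta_2)$ is a symmetric $\mathcal{A}$-subbimodule of $\mathcal{X}$ and $\mathfrak{S}(\delta_2)\subseteq Z_{\mathcal{X}}(\mathcal{A})$; moreover $\mathfrak{S}(\delta_2)$ is a $\mathcal{U}$-subbimodule of $\mathcal{X}$.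
   Context: The Lau product $\mathcal{A}\times_{\theta}\mathcal{U}$ is $\mathcal{A}\times\mathcal{U}$ with norm $\|(a,u)\|=\|a\|+\|u\|$ and product $(a,u)(a',u')=(aa',\theta(a)u'+\theta(a')u+uu')$. A Banach $(\mathcal{A}\times_{\theta}\mathcal{U})$-bimodule $\mathcal{X}$ is an $\mathcal{A}$-bimodule via $ax=(a,0)x$, $xa=x(a,0)$ and a $\mathcal{U}$-bimodule via $ux=(0,u)x$, $xu=x(0,u)$. For a linear map $T:\mathcal{E}\to\mathcal{F}$ between Banach spaces, the separating space is $\mathfrak{S}(T)=\{y\in\mathcal{F}:\exists (x_n)\subseteq\mathcal{E},\ x_n\to0,\ T(x_n)\to y\}$. $\mathrm{ann}_{\mathcal{X}}\mathcal{U}=\{x\in\mathcal{X}: ux=xu=0\ \forall u\in\mathcal{U}\}$; $Z_{\mathcal{X}}(\mathcal{A})=\{x\in\mathcal{X}: ax=xa\ \forall a\in\mathcal{A}\}$. A subbimodule $\mathcal{S}$ is symmetric (as $\mathcal{A}$-bimodule) if $as=sa$ for all $a\in\mathcal{A},s\in\mathcal{S}$. *)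

(* Defs.v *)
From HB Require Import structures.
From mathcomp Require Import all_boot all_order all_algebra.
From mathcomp Require Import all_classical all_reals all_analysis.
Set Implicit Arguments. Unset Strict Implicit. Unset Printing Implicit Defensive.
Import Order.TTheory GRing.Theory Num.Theory.
Import numFieldNormedType.Exports.
Local Open Scope classical_set_scope.
Local Open Scope ring_scope.

(* Scalars: an arbitrary numFieldType K (covers the real and complex cases). *)

Definition is_banach_algebra (K : numFieldType) (A : completeNormedModType K)
    (mul : A -> A -> A) : Prop :=
  [/\ (forall a b c, mul (mul a b) c = mul a (mul b c)),
      (forall k a b c, mul (k *: a + b) c = k *: mul a c + mul b c),
      (forall k a b c, mul a (k *: b + c) = k *: mul a b + mul a c)
    & (forall a b, `|mul a b| <= `|a| * `|b|)].

Definition is_character (K : numFieldType) (A : completeNormedModType K)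
    (mul : A -> A -> A) (theta : A -> K) : Prop :=
  (forall k a b, theta (k *: a + b) = k * theta a + theta b) /\
  (forall a b, theta (mul a b) = theta a * theta b).

Section Lau.
Variables (K : numFieldType) (A U : completeNormedModType K).
Variables (mulA : A -> A -> A) (mulU : U -> U -> U) (theta : A -> K).

Definition lau_norm (p : A * U) : K := `|p.1| + `|p.2|.

Definition lau_scale (k : K) (p : A * U) : A * U := (k *: p.1, k *: p.2).
Definition lau_add (p q : A * U) : A * U := (p.1 + q.1, p.2 + q.2).

Definition lau_mul (p q : A * U) : A * U :=
  (mulA p.1 q.1, theta p.1 *: q.2 + theta q.1 *: p.2 + mulU p.2 q.2).
End Lau.

Definition is_lau_banach_bimodule (K : numFieldType)
    (A U : completeNormedModType K) (mulA : A -> A -> A) (mulU : U -> U -> U)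
    (theta : A -> K) (X : completeNormedModType K)
    (lm : A * U -> X -> X) (rm : X -> A * U -> X) : Prop :=

  (forall k p q x, lm (lau_add (lau_scale k p) q) x = k *: lm p x + lm q x) /\
  (forall k p x y, lm p (k *: x + y) = k *: lm p x + lm p y) /\
  (forall k p q x, rm x (lau_add (lau_scale k p) q) = k *: rm x p + rm x q) /\
  (forall k p x y, rm (k *: x + y) p = k *: rm x p + rm y p) /\
  (forall p q x, lm (lau_mul mulA mulU theta p q) x = lm p (lm q x)) /\
  (forall p q x, rm x (lau_mul mulA mulU theta p q) = rm (rm x p) q) /\
  (forall p q x, lm p (rm x q) = rm (lm p x) q) /\
  (exists2 C : K, 0 < C &
        forall p x, `|lm p x| <= C * lau_norm p * `|x| /\
                    `|rm x p| <= C * lau_norm p * `|x|).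

Definition is_lau_derivation (K : numFieldType)
    (A U : completeNormedModType K) (mulA : A -> A -> A) (mulU : U -> U -> U)
    (theta : A -> K) (X : completeNormedModType K)
    (lm : A * U -> X -> X) (rm : X -> A * U -> X) (D : A * U -> X) : Prop :=
  (forall k p q, D (lau_add (lau_scale k p) q) = k *: D p + D q) /\
  (forall p q, D (lau_mul mulA mulU theta p q) = lm p (D q) + rm (D p) q).

Definition separating_space (K : numFieldType) (E F : normedModType K)
    (T : E -> F) : set F :=
  [set y | exists x : nat -> E,
      x n @[n --> \oo] --> (0 : E) /\ T (x n) @[n --> \oo] --> y].

Definition is_subspace (K : numFieldType) (X : normedModType K) (S : set X) :=
  [/\ S 0, (forall x y, S x -> S y -> S (x + y))
         & (forall (k : K) x, S x -> S (k *: x))].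

Section Sub.
Variables (K : numFieldType) (A U X : completeNormedModType K).
Variables (lm : A * U -> X -> X) (rm : X -> A * U -> X).

Definition actA_l (a : A) (x : X) := lm (a, 0) x.
Definition actA_r (x : X) (a : A) := rm x (a, 0).
Definition actU_l (u : U) (x : X) := lm (0, u) x.
Definition actU_r (x : X) (u : U) := rm x (0, u).

Definition is_A_subbimodule (S : set X) : Prop :=
  is_subspace S /\
  forall a s, S s -> S (actA_l a s) /\ S (actA_r s a).

Definition is_U_subbimodule (S : set X) : Prop :=
  is_subspace S /\
  forall u s, S s -> S (actU_l u s) /\ S (actU_r s u).

Definition is_symmetric_A (S : set X) : Prop :=
  forall a s, S s -> actA_l a s = actA_r s a.

Definition ann_U : set X :=
  [set x | forall u, actU_l u x = 0 /\ actU_r x u = 0].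

Definition center_A : set X :=
  [set x | forall a, actA_l a x = actA_r x a].
End Sub.

(* Main.v *)
Require Import Defs.
From HB Require Import structures.
From mathcomp Require Import all_boot all_order all_algebra.
From mathcomp Require Import all_classical all_reals all_analysis.
Set Implicit Arguments. Unset Strict Implicit. Unset Printing Implicit Defensive.
Import Order.TTheory GRing.Theory Num.Theory.
Import numFieldNormedType.Exports.
Local Open Scope classical_set_scope.
Local Open Scope ring_scope.

(* Each claim follows by passing to the limit in an identity that expresses
   delta (g x) or h (delta x) up to a bounded linear error term.  The inclusion
   of S(delta_1) in ann_X U needs theta to be bounded, but no automatic
   continuity theorem: from (y u) a = theta(a) (y u) and
   a (u y) = theta(a) (u y), boundedness of the module action makes theta
   bounded as soon as y u or u y is nonzero for some u and y. *)

(** Boundedness carries an explicit constant, the form in which algebra and module inequalities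
    supply it; constants can then be added, scaled and divided. *)
Definition bounded_linear (K : numFieldType) (E F : normedModType K)
    (f : E -> F) : Prop :=
  (forall k x y, f (k *: x + y) = k *: f x + f y) /\
  exists2 C : K, 0 <= C & forall x, `|f x| <= C * `|x|.

(** * Calculus of bounded linear maps *)

Section BoundedLinear.
Context {K : numFieldType} {E F : normedModType K}.
Implicit Types f g : E -> F.

Lemma bounded_linear_add f g :
  bounded_linear f -> bounded_linear g -> bounded_linear (fun x => f x + g x).
Proof.
move=> [flin [C C0 fC]] [glin [C' C'0 gC']]; split.
  by move=> k x y; rewrite flin glin scalerDr addrACA.
exists (C + C'); first exact: addr_ge0.
by move=> x; rewrite mulrDl (le_trans (ler_normD _ _))// lerD.
Qed.

Lemma bounded_linear_scale c f :
  bounded_linear f -> bounded_linear (fun x => c *: f x).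
Proof.
move=> [flin [C C0 fC]]; split.
  by move=> k x y; rewrite flin scalerDr !scalerA mulrC.
exists (`|c| * C); first exact: mulr_ge0.
by move=> x; rewrite normrZ -mulrA ler_wpM2l.
Qed.

Lemma bounded_linear_opp f :
  bounded_linear f -> bounded_linear (fun x => - f x).
Proof.
move=> /(bounded_linear_scale (-1)).
by under eq_fun do rewrite scaleN1r.
Qed.

Lemma bounded_linear_id : bounded_linear (@idfun E).
Proof. by split=> //; exists 1 => // x; rewrite mul1r. Qed.

Lemma linear0_of f : (forall k x y, f (k *: x + y) = k *: f x + f y) -> f 0 = 0.
Proof.
by move=> flin; have := flin (-1) 0 0; rewrite scaler0 addr0 scaleN1r addNr.
Qed.

Lemma bounded_linear_cvg f (x : nat -> E) (y : E) :
  bounded_linear f -> x n @[n --> \oo] --> y -> f (x n) @[n --> \oo] --> f y.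
Proof.
move=> [flin [C C0 fC]] xy; apply/cvgrPdist_lt => e e0.
(* [C] may be 0, so [e] is divided by [C + 1] instead. *)
have C1 : 0 < C + 1 by rewrite ltr_wpDl.
have d0 : 0 < e / (C + 1) by rewrite divr_gt0.
have /cvgrPdist_lt/(_ _ d0) := xy; apply: filterS => n xyn.
have -> : f y - f (x n) = f (y - x n).
  by rewrite addrC -scaleN1r -flin scaleN1r addrC.
rewrite (le_lt_trans (fC _))//.
rewrite (@le_lt_trans _ _ ((C + 1) * `|y - x n|))//.
  by rewrite ler_wpM2r// lerDl.
by rewrite mulrC -ltr_pdivlMr.
Qed.

End BoundedLinear.

(** * Limit arguments for separating spaces *)

Section SeparatingSpace.
Context {K : numFieldType} {E F : normedModType K} (T : E -> F).
Hypothesis Tlin : forall k x y, T (k *: x + y) = k *: T x + T y.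

Lemma separating_space_subspace : is_subspace (separating_space T).
Proof.
split.
- exists (fun=> 0); rewrite (linear0_of Tlin).
  by split; exact: cvg_cst.
- move=> y y' [x [x0 xy]] [x' [x'0 xy']]; exists (fun n => x n + x' n); split.
    by rewrite -[0]addr0; exact: cvgD.
  under eq_fun do rewrite -[x _]scale1r Tlin scale1r.
  exact: cvgD.
- move=> k y [x [x0 xy]]; exists (fun n => k *: x n); split.
    by rewrite -[0](scaler0 _ k); exact: cvgZr.
  under eq_fun do rewrite -[_ *: _]addr0 Tlin (linear0_of Tlin) addr0.
  exact: cvgZr.
Qed.

(** If [x n] tends to 0 and [T (x n)] to [y], then [g (x n)] witnesses [h y], because the error
    [r (x n)] tends to 0. For a derivation, [g] is multiplication by a fixed element, [h] its action
    on the module, and [r] the other Leibniz term. *)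
Lemma separating_space_stable (g : E -> E) (h : F -> F) (r : E -> F) y :
  bounded_linear g -> bounded_linear h -> bounded_linear r ->
  (forall x, T (g x) = h (T x) + r x) ->
  separating_space T y -> separating_space T (h y).
Proof.
move=> gb hb rb TE [x [x0 xy]]; exists (fun n => g (x n)); split.
  by rewrite -(linear0_of gb.1); exact: bounded_linear_cvg.
under eq_fun do rewrite TE.
rewrite -[h y]addr0 -(linear0_of rb.1).
by apply: cvgD; exact: bounded_linear_cvg.
Qed.

(** Along a witnessing sequence, [h (T (x n))] tends to [h y] and, being [r (x n)], also to 0;
    limits in a normed space are unique. *)
Lemma separating_space_ker {G : normedModType K} (h : F -> G) (r : E -> G) y :
  bounded_linear h -> bounded_linear r -> (forall x, h (T x) = r x) ->
  separating_space T y -> h y = 0.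
Proof.
move=> hb rb hTE [x [x0 xy]].
apply: (@cvg_unique _ (@norm_hausdorff _ G) (h (T (x n)) @[n --> \oo])).
  exact: bounded_linear_cvg.
move=> /=; under eq_fun do rewrite hTE.
by rewrite -(linear0_of rb.1); exact: bounded_linear_cvg.
Qed.

End SeparatingSpace.

(** * Products in the Lau algebra and its module actions *)

Section LauModule.
Context {K : numFieldType} {A U X : completeNormedModType K}.
Context {mulA : A -> A -> A} {mulU : U -> U -> U} {theta : A -> K}.
Context {lm : A * U -> X -> X} {rm : X -> A * U -> X}.
Hypothesis algA : is_banach_algebra mulA.
Hypothesis algU : is_banach_algebra mulU.
Hypothesis thetaP : is_character mulA theta.
Hypothesis modX : is_lau_banach_bimodule mulA mulU theta lm rm.

Lemma banach_algebra_bounded_mull (B : completeNormedModType K)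
    (mul : B -> B -> B) (b : B) :
  is_banach_algebra mul -> bounded_linear (mul b).
Proof. by case=> _ _ mulr mulb; split=> //; exists `|b|. Qed.

Lemma banach_algebra_bounded_mulr (B : completeNormedModType K)
    (mul : B -> B -> B) (b : B) :
  is_banach_algebra mul -> bounded_linear (mul^~ b).
Proof.
by case=> _ mull _ mulb; split=> //; exists `|b| => // x; rewrite mulrC.
Qed.

(** Restricts linearity stated on pairs to the first factor. *)
Lemma lau_combA k (a b : A) :
  lau_add (lau_scale k (a, 0)) (b, 0) = (k *: a + b, 0 : U).
Proof. by rewrite /lau_add /lau_scale /= scaler0 addr0. Qed.

Lemma lau_combU k (u v : U) :
  lau_add (lau_scale k (0, u)) (0, v) = (0 : A, k *: u + v).
Proof. by rewrite /lau_add /lau_scale /= scaler0 addr0. Qed.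

Lemma lau_norm_ge0 (p : A * U) : 0 <= lau_norm p.
Proof. exact: addr_ge0. Qed.

Lemma lau_normA (a : A) : lau_norm (a, 0 : U) = `|a|.
Proof. by rewrite /lau_norm normr0 addr0. Qed.

Lemma lau_normU (u : U) : lau_norm (0 : A, u) = `|u|.
Proof. by rewrite /lau_norm normr0 add0r. Qed.

(** Bounded in the module variable: these actions serve as [h] in the limit lemmas. *)
Lemma bounded_lm p : bounded_linear (lm p).
Proof.
case: modX => _ [ll [_ [_ [_ [_ [_ [C C0 bd]]]]]]]; split; first by move=> *.
exists (C * lau_norm p) => [|x]; last by have [] := bd p x.
by rewrite mulr_ge0 ?lau_norm_ge0 // ltW.
Qed.

Lemma bounded_rm p : bounded_linear (rm^~ p).
Proof.
case: modX => _ [_ [_ [rl [_ [_ [_ [C C0 bd]]]]]]]; split; first by move=> *.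
exists (C * lau_norm p) => [|x]; last by have [] := bd p x.
by rewrite mulr_ge0 ?lau_norm_ge0 // ltW.
Qed.

(** Bounded in the algebra variable: such maps serve as error terms [r]. *)
Lemma bounded_actA_l x : bounded_linear (fun a => actA_l lm a x).
Proof.
case: modX => ll [_ [_ [_ [_ [_ [_ [C C0 bd]]]]]]]; split.
  by move=> k a b; rewrite /actA_l -lau_combA ll.
exists (C * `|x|) => [|a]; first by rewrite mulr_ge0 // ltW.
by have [+ _] := bd (a, 0) x; rewrite lau_normA mulrAC.
Qed.

Lemma bounded_actA_r x : bounded_linear (fun a => actA_r rm x a).
Proof.
case: modX => _ [_ [rl [_ [_ [_ [_ [C C0 bd]]]]]]]; split.
  by move=> k a b; rewrite /actA_r -lau_combA rl.
exists (C * `|x|) => [|a]; first by rewrite mulr_ge0 // ltW.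
by have [_ +] := bd (a, 0) x; rewrite lau_normA mulrAC.
Qed.

Lemma bounded_actU_l x : bounded_linear (fun u => actU_l lm u x).
Proof.
case: modX => ll [_ [_ [_ [_ [_ [_ [C C0 bd]]]]]]]; split.
  by move=> k u v; rewrite /actU_l -lau_combU ll.
exists (C * `|x|) => [|u]; first by rewrite mulr_ge0 // ltW.
by have [+ _] := bd (0, u) x; rewrite lau_normU mulrAC.
Qed.

Lemma bounded_actU_r x : bounded_linear (fun u => actU_r rm x u).
Proof.
case: modX => _ [_ [rl [_ [_ [_ [_ [C C0 bd]]]]]]]; split.
  by move=> k u v; rewrite /actU_r -lau_combU rl.
exists (C * `|x|) => [|u]; first by rewrite mulr_ge0 // ltW.
by have [_ +] := bd (0, u) x; rewrite lau_normU mulrAC.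
Qed.

Lemma lau_mulAA a b : lau_mul mulA mulU theta (a, 0) (b, 0) = (mulA a b, 0).
Proof.
rewrite /lau_mul /= (linear0_of (banach_algebra_bounded_mull _ algU).1).
by rewrite !scaler0 !addr0.
Qed.

Lemma lau_mulUU u v : lau_mul mulA mulU theta (0, u) (0, v) = (0, mulU u v).
Proof.
(* [K^o] is the scalar field as a normed module over itself, so [theta] counts as a linear map. *)
have t0 : theta 0 = 0 by exact: (@linear0_of _ A K^o theta thetaP.1).
rewrite /lau_mul /= (linear0_of (banach_algebra_bounded_mull _ algA).1).
by rewrite t0 !scale0r !add0r.
Qed.

(** With [lau_mulUA], the source of every later [theta a]: on the copy of [U], [A] acts from both
    sides through the character. *)
Lemma lau_mulAU a u : lau_mul mulA mulU theta (a, 0) (0, u) = (0, theta a *: u).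
Proof.
rewrite /lau_mul /= (linear0_of (banach_algebra_bounded_mull _ algA).1).
by rewrite (linear0_of (banach_algebra_bounded_mulr _ algU).1) scaler0 !addr0.
Qed.

Lemma lau_mulUA u a : lau_mul mulA mulU theta (0, u) (a, 0) = (0, theta a *: u).
Proof.
rewrite /lau_mul /= (linear0_of (banach_algebra_bounded_mulr _ algA).1).
rewrite (linear0_of (banach_algebra_bounded_mull _ algU).1) scaler0.
by rewrite add0r addr0.
Qed.

Lemma actA_actU_l a u x :
  actA_l lm a (actU_l lm u x) = theta a *: actU_l lm u x.
Proof.
case: modX => _ [_ [_ [_ [la _]]]].
rewrite /actA_l /actU_l -la lau_mulAU.
have [ulin _] := bounded_actU_l x.
by have := ulin (theta a) u 0; rewrite (linear0_of ulin) !addr0.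
Qed.

Lemma actU_actA_r a u x :
  actA_r rm (actU_r rm x u) a = theta a *: actU_r rm x u.
Proof.
case: modX => _ [_ [_ [_ [_ [ra _]]]]].
rewrite /actA_r /actU_r -ra lau_mulUA.
have [ulin _] := bounded_actU_r x.
by have := ulin (theta a) u 0; rewrite (linear0_of ulin) !addr0.
Qed.

(** The nonzero [z] bounds the character: [|theta a| * |z| = |f a| <= C * |a|]. Dividing by [|z|]
    and multiplying by [|z'|] gives the constant. *)
Lemma bounded_character_scale (f : A -> X) (z z' : X) :
  bounded_linear f -> (forall a, f a = theta a *: z) -> z != 0 ->
  bounded_linear (fun a => theta a *: z').
Proof.
move=> [_ [C C0 fC]] fE z0; split.
  by move=> k a b; rewrite thetaP.1 scalerDl scalerA.
have z0' : 0 < `|z| by rewrite normr_gt0.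
exists (C / `|z| * `|z'|) => [|a]; first by rewrite mulr_ge0 ?divr_ge0.
rewrite normrZ mulrAC ler_wpM2r // mulrAC ler_pdivlMr //.
by rewrite -normrZ -fE.
Qed.

(** * Leibniz identities and the separating spaces of the two components *)

Section Derivation.
Context {D : A * U -> X}.
Hypothesis derD : is_lau_derivation mulA mulU theta lm rm D.
Let delta1 (a : A) := D (a, 0).
Let delta2 (u : U) := D (0, u).

Lemma delta1_linear k a b : delta1 (k *: a + b) = k *: delta1 a + delta1 b.
Proof. by rewrite /delta1 -lau_combA derD.1. Qed.

Lemma delta2_linear k u v : delta2 (k *: u + v) = k *: delta2 u + delta2 v.
Proof. by rewrite /delta2 -lau_combU derD.1. Qed.

Lemma delta2_scale k u : delta2 (k *: u) = k *: delta2 u.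
Proof.
by rewrite -[k *: u]addr0 delta2_linear (linear0_of delta2_linear) addr0.
Qed.

Lemma delta1_mul a b :
  delta1 (mulA a b) = actA_l lm a (delta1 b) + actA_r rm (delta1 a) b.
Proof. by rewrite /delta1 -lau_mulAA derD.2. Qed.

Lemma delta2_mul u v :
  delta2 (mulU u v) = actU_l lm u (delta2 v) + actU_r rm (delta2 u) v.
Proof. by rewrite /delta2 -lau_mulUU derD.2. Qed.

(** Apply [D] to [(a, 0) (0, u) = (0, theta a *: u)]; the next lemma uses the opposite order of
    factors. *)
Lemma delta2_actA_l a u :
  theta a *: delta2 u = actA_l lm a (delta2 u) + actU_r rm (delta1 a) u.
Proof. by rewrite -delta2_scale /delta2 -lau_mulAU derD.2. Qed.

Lemma delta2_actA_r a u :
  theta a *: delta2 u = actA_r rm (delta2 u) a + actU_l lm u (delta1 a).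
Proof. by rewrite -delta2_scale /delta2 -lau_mulUA derD.2 addrC. Qed.

Lemma separating_delta1_subbimodule :
  is_A_subbimodule lm rm (separating_space delta1).
Proof.
split; first exact: separating_space_subspace delta1_linear.
move=> a s Ss; split.
  apply: (separating_space_stable (h := actA_l lm a)) Ss.
  - exact: (banach_algebra_bounded_mull a algA).
  - exact: bounded_lm.
  - exact: (bounded_actA_r (delta1 a)).
  - by move=> b; rewrite delta1_mul.
apply: (separating_space_stable (h := (actA_r rm)^~ a)) Ss.
- exact: (banach_algebra_bounded_mulr a algA).
- exact: bounded_rm.
- exact: (bounded_actA_l (delta1 a)).
- by move=> b; rewrite delta1_mul addrC.
Qed.

Lemma separating_delta1_ann : separating_space delta1 `<=` ann_U lm rm.
Proof.
move=> y Sy u; split.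
  (* Assuming [u y] nonzero is what makes [theta] bounded, hence the error term [r] below; the limit
     argument then forces [u y = 0] after all. *)
  have [//|z0] := eqVneq (actU_l lm u y) 0.
  apply: (separating_space_ker (h := actU_l lm u)
    (r := fun a => theta a *: delta2 u - actA_r rm (delta2 u) a)) Sy.
  - exact: bounded_lm.
  - apply: bounded_linear_add.
      (* Here [f] is the orbit map of [u y], equal to [theta a *: (u y)], while [z'] is
         [delta2 u]. *)
      apply: (bounded_character_scale _ (bounded_actA_l (actU_l lm u y))) z0.
      by move=> a; exact: actA_actU_l.
    exact/bounded_linear_opp/bounded_actA_r.
  - by move=> a; rewrite delta2_actA_r addrC addKr.
have [//|z0] := eqVneq (actU_r rm y u) 0.
apply: (separating_space_ker (h := (actU_r rm)^~ u)
  (r := fun a => theta a *: delta2 u - actA_l lm a (delta2 u))) Sy.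
- exact: bounded_rm.
- apply: bounded_linear_add.
    apply: (bounded_character_scale _ (bounded_actA_r (actU_r rm y u))) z0.
    by move=> a; exact: actU_actA_r.
  exact/bounded_linear_opp/bounded_actA_l.
- by move=> a; rewrite delta2_actA_l addrC addKr.
Qed.

(** Here [a] is fixed and [u] varies, so [theta a] is a constant scalar and the defect of [delta2 u]
    from being an eigenvector is bounded in [u]. *)
Lemma separating_delta2_actA_l a y :
  separating_space delta2 y -> actA_l lm a y = theta a *: y.
Proof.
move=> Sy; apply/eqP; rewrite -subr_eq0; apply/eqP.
apply: (separating_space_ker (h := fun x => actA_l lm a x - theta a *: x)
  (r := fun u => - actU_r rm (delta1 a) u)) Sy.
- apply: bounded_linear_add; first exact: bounded_lm.
  exact/bounded_linear_opp/bounded_linear_scale/bounded_linear_id.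
- exact/bounded_linear_opp/bounded_actU_r.
- by move=> u; rewrite delta2_actA_l opprD addNKr.
Qed.

Lemma separating_delta2_actA_r a y :
  separating_space delta2 y -> actA_r rm y a = theta a *: y.
Proof.
move=> Sy; apply/eqP; rewrite -subr_eq0; apply/eqP.
apply: (separating_space_ker (h := fun x => actA_r rm x a - theta a *: x)
  (r := fun u => - actU_l lm u (delta1 a))) Sy.
- apply: bounded_linear_add; first exact: bounded_rm.
  exact/bounded_linear_opp/bounded_linear_scale/bounded_linear_id.
- exact/bounded_linear_opp/bounded_actU_l.
- by move=> u; rewrite delta2_actA_r opprD addNKr.
Qed.

(** Both actions of [a] on this space are multiplication by [theta a], so closure under scalars
    suffices. *)
Lemma separating_delta2_A_subbimodule :
  is_A_subbimodule lm rm (separating_space delta2).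
Proof.
have [S0 SD SZ] := separating_space_subspace delta2_linear.
split=> // a s Ss; rewrite separating_delta2_actA_l//.
by rewrite separating_delta2_actA_r//; split; exact: SZ.
Qed.

Lemma separating_delta2_center : separating_space delta2 `<=` center_A lm rm.
Proof.
by move=> s Ss a; rewrite separating_delta2_actA_l// separating_delta2_actA_r.
Qed.

Lemma separating_delta2_U_subbimodule :
  is_U_subbimodule lm rm (separating_space delta2).
Proof.
split; first exact: separating_space_subspace delta2_linear.
move=> u s Ss; split.
  apply: (separating_space_stable (h := actU_l lm u)) Ss.
  - exact: (banach_algebra_bounded_mull u algU).
  - exact: bounded_lm.
  - exact: (bounded_actU_r (delta2 u)).
  - by move=> v; rewrite delta2_mul.
apply: (separating_space_stable (h := (actU_r rm)^~ u)) Ss.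
- exact: (banach_algebra_bounded_mulr u algU).
- exact: bounded_rm.
- exact: (bounded_actU_l (delta2 u)).
- by move=> v; rewrite delta2_mul addrC.
Qed.

End Derivation.
End LauModule.

Theorem theorem2p5 (K : numFieldType) (A U X : completeNormedModType K)
    (mulA : A -> A -> A) (mulU : U -> U -> U) (theta : A -> K)
    (lm : A * U -> X -> X) (rm : X -> A * U -> X) (D : A * U -> X) :
  is_banach_algebra mulA -> is_banach_algebra mulU ->
  is_character mulA theta -> (exists a, theta a != 0) ->
  is_lau_banach_bimodule mulA mulU theta lm rm ->
  is_lau_derivation mulA mulU theta lm rm D ->
  let delta1 := fun a : A => D (a, 0) in
  let delta2 := fun u : U => D (0, u) in
  (is_A_subbimodule lm rm (separating_space delta1) /\
   separating_space delta1 `<=` ann_U lm rm) /\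
  (is_A_subbimodule lm rm (separating_space delta2) /\
   is_symmetric_A lm rm (separating_space delta2) /\
   separating_space delta2 `<=` center_A lm rm /\
   is_U_subbimodule lm rm (separating_space delta2)).
Proof.
move=> algA algU thetaP _ modX derD delta1 delta2.
(* Used twice: symmetry and inclusion in the centre are the same pointwise identity. *)
have center := separating_delta2_center algA algU modX derD.
split; split.
- exact: (separating_delta1_subbimodule algA algU modX derD).
- exact: (separating_delta1_ann algA algU thetaP modX derD).
- exact: (separating_delta2_A_subbimodule algA algU modX derD).
- split; first by move=> a s /center.
  split=> //; exact: (separating_delta2_U_subbimodule algA algU thetaP modX derD).
Qed.
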